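(* Let $0<\delta,\epsilon<1$ with $\epsilon\le \log^{-2}(\delta^{-1})$, and let $k = O(\epsilon^{-2}\log(1/\delta))$. There exists a universal constant $\gamma$ and a probability distribution $\mathcal{D}$ over $k\times d$ real matrices such that, if $M\sim\mathcal{D}$, then for every fixed $x\in\mathbb{R}^d$ the following hold. First, $$P\big((1-\epsilon)\|x\|_2 \le \|Mx\|_2 \le (1+\epsilon)\|x\|_2\big)\ge 1-\gamma\delta.$$ Second, $Mx$ can be computed in time $$O\!\left(\frac{1}{\epsilon}\left(\frac{\log(1/\delta)\,\log\log\log(1/\delta)}{\log\log(1/\delta)}\right)^2 \|x\|_0\right).$$ Third, $M$ can be constructed using random vectors with $O(\log(1/\delta))$-wise independent entries.
   Context: $\|x\|_0$ denotes the number of non-zero coordinates of $x$. A random vector has $r$-wise independent entries if every $r$ of its entries are mutually independent and uniformly distributed on their range. *)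

(* Defs.v *)
From mathcomp Require Import all_boot all_order all_algebra.
From mathcomp Require Import all_classical all_reals all_analysis.

Set Implicit Arguments.
Unset Strict Implicit.
Unset Printing Implicit Defensive.

Import Order.TTheory GRing.Theory Num.Theory.
Import numFieldNormedType.Exports.

Local Open Scope classical_set_scope.
Local Open Scope ring_scope.

(* The library norm `|x| on matrices is the sup norm. *)
Definition l2norm (R : rcfType) (n : nat) (x : 'cV[R]_n) : R :=
  Num.sqrt (\sum_(i < n) x i 0 ^+ 2).

Definition l0norm (R : nzRingType) (n : nat) (x : 'cV[R]_n) : nat :=
  #|[set i : 'I_n | x i 0 != 0]%SET|.

(* k x d real matrices with the Borel sigma-algebra. *)
Definition borel_matrix (R : realType) (k d : nat) :=
  g_sigma_algebraType (@open 'M[R]_(k, d)).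

(** * Independence

    Random elements below have finite ranges, so events {X i \in B} range over
    all B. *)

Definition mutually_independent (R : realType) (disp : measure_display)
    (Om : measurableType disp) (P : probability Om R) (I : finType)
    (T : I -> Type) (X : forall i, Om -> T i) (S : {set I}) : Prop :=
  forall (J : {set I}) (B : forall i, set (T i)), J \subset S ->
    P (\bigcap_(i in [set i | i \in J]) X i @^-1` B i) =
    (\prod_(i in J) P (X i @^-1` B i))%E.

Definition uniform_entry (R : realType) (disp : measure_display)
    (Om : measurableType disp) (P : probability Om R) (T : finType)
    (X : Om -> T) : Prop :=
  forall a : T, P (X @^-1` [set a]) = (#|T|%:R^-1)%:E.

(* If r exceeds the length n, this is full independence. *)
Definition rwise_independent_entries (R : realType) (disp : measure_display)
    (Om : measurableType disp) (P : probability Om R) (r n : nat)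
    (T : finType) (X : Om -> {ffun 'I_n -> T}) : Prop :=
  forall S : {set 'I_n}, (#|S| <= r)%N ->
    mutually_independent P (fun j w => X w j) S /\
    (forall j, j \in S -> uniform_entry P (fun w => X w j)).

(* The values of m random vectors, the i-th of length n i and with entries in
   a set of q i elements. *)
Definition seeds (m : nat) (n q : 'I_m -> nat) : Type :=
  forall i : 'I_m, {ffun 'I_(n i) -> 'I_(q i)}.

(* D is the law of F (V_1, ..., V_m) for some independent random vectors V_i,
   each of which has r-wise independent entries (and nothing more is known
   about the joint law of the entries of V_i). *)
Definition constructed_from (R : realType) (k d m : nat) (n q : 'I_m -> nat)
    (r : nat) (F : seeds n q -> 'M[R]_(k, d))
    (D : probability (borel_matrix R k d) R) : Prop :=
  exists (disp : measure_display) (Om : measurableType disp)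
    (P : probability Om R)
    (V : forall i : 'I_m, Om -> {ffun 'I_(n i) -> 'I_(q i)}),
  [/\ forall i v, measurable (V i @^-1` [set v]),
      forall i, rwise_independent_entries P r (V i),
      mutually_independent P V [set: 'I_m]%SET &
      forall A : set (borel_matrix R k d), measurable A ->
        D A = P [set w | A (F (fun i => V i w))]].

(** * Running time: a unit-cost real RAM

    There are countably many integer and real registers and arrays, all
    addressed by natural numbers; an array cell is reached through the content
    of an integer register.  Integers only support addition and truncated
    subtraction, so that no computation can be packed into large integers. *)

Inductive instr : Type :=
  | IConst of nat & nat               (* i[a] := c *)
  | IAdd of nat & nat & nat           (* i[a] := i[b] + i[c] *)
  | ISub of nat & nat & nat           (* i[a] := i[b] - i[c], truncated *)
  | ILoad of nat & nat & nat          (* i[a] := IA[t][i[b]] *)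
  | IStore of nat & nat & nat         (* IA[t][i[b]] := i[a] *)
  | RAdd of nat & nat & nat           (* x[a] := x[b] + x[c] *)
  | RSub of nat & nat & nat           (* x[a] := x[b] - x[c] *)
  | RMul of nat & nat & nat           (* x[a] := x[b] * x[c] *)
  | RDiv of nat & nat & nat           (* x[a] := x[b] / x[c] *)
  | RLoad of nat & nat & nat          (* x[a] := RA[t][i[b]] *)
  | RStore of nat & nat & nat         (* RA[t][i[b]] := x[a] *)
  | Jump of nat                       (* goto l *)
  | JumpIfZero of nat & nat           (* if i[a] = 0 goto l *)
  | JumpIfPos of nat & nat.           (* if 0 < x[a] goto l *)

Record mstate (R : Type) : Type := MState {
  pc : nat;
  ireg : nat -> nat;
  rreg : nat -> R;
  iarr : nat -> nat -> nat;
  rarr : nat -> nat -> R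
}.

Definition upd (T : Type) (f : nat -> T) (a : nat) (v : T) : nat -> T :=
  fun b => if b == a then v else f b.

Definition upd2 (T : Type) (f : nat -> nat -> T) (t a : nat) (v : T) :=
  upd f t (upd (f t) a v).

Definition exec (R : realFieldType) (c : instr) (s : mstate R) : mstate R :=
  let: MState p i x IA RA := s in
  match c with
  | IConst a n => MState p.+1 (upd i a n) x IA RA
  | IAdd a b c => MState p.+1 (upd i a (i b + i c)%N) x IA RA
  | ISub a b c => MState p.+1 (upd i a (i b - i c)%N) x IA RA
  | ILoad a t b => MState p.+1 (upd i a (IA t (i b))) x IA RA
  | IStore a t b => MState p.+1 i x (upd2 IA t (i b) (i a)) RA
  | RAdd a b c => MState p.+1 i (upd x a (x b + x c)) IA RA
  | RSub a b c => MState p.+1 i (upd x a (x b - x c)) IA RA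
  | RMul a b c => MState p.+1 i (upd x a (x b * x c)) IA RA
  | RDiv a b c => MState p.+1 i (upd x a (x b / x c)) IA RA
  | RLoad a t b => MState p.+1 i (upd x a (RA t (i b))) IA RA
  | RStore a t b => MState p.+1 i x IA (upd2 RA t (i b) (x a))
  | Jump l => MState l i x IA RA
  | JumpIfZero a l => MState (if i a == 0%N then l else p.+1) i x IA RA
  | JumpIfPos a l => MState (if 0 < x a then l else p.+1) i x IA RA
  end.

Definition halted (R : Type) (prog : seq instr) (s : mstate R) : bool :=
  (size prog <= pc s)%N.

Definition step (R : realFieldType) (prog : seq instr) (s : mstate R) :=
  if halted prog s then s else exec (nth (Jump 0) prog (pc s)) s.

(* Coordinates of the nonzero entries, in increasing order. *)
Definition support_seq (R : nzRingType) (d : nat) (x : 'cV[R]_d) : seq 'I_d :=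
  [seq j <- enum 'I_d | x j 0 != 0].

(* Arrays 0 hold the stored data structure (di, dr); arrays 1 hold x in sparse
   form, i.e., the positions and values of its nonzero coordinates, whose
   number is in integer register 0.  All other cells are 0. *)
Definition init (R : realFieldType) (d : nat) (di : seq nat) (dr : seq R)
    (x : 'cV[R]_d) : mstate R :=
  MState 0%N
    (upd (fun=> 0%N) 0%N (l0norm x))
    (fun=> 0)
    (fun t a => match t with
       | 0 => nth 0%N di a
       | 1 => nth 0%N [seq nat_of_ord j | j <- support_seq x] a
       | _ => 0%N
       end)
    (fun t a => match t with
       | 0 => nth 0 dr a
       | 1 => nth 0 [seq x j 0 | j <- support_seq x] a
       | _ => 0
       end).

(* With M stored in memory in a suitable way, which depends on M only, prog
   computes M x for every x, in at most time x steps; the output is in the real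
   array 2, which initially is 0. *)
Definition computes_in_time (R : realFieldType) (prog : seq instr) (k d : nat)
    (M : 'M[R]_(k, d)) (time : 'cV[R]_d -> R) : Prop :=
  exists (di : seq nat) (dr : seq R), forall x : 'cV[R]_d,
  exists t : nat,
    let s := iter t (step prog) (init di dr x) in
    [/\ t%:R <= time x,
        halted prog s &
        forall i : 'I_k, rarr s 2 i = (M *m x) i 0].

(* Main.v *)
(* The matrix has s blocks of B rows. Block t sends column j to one row h(t, j)
   with sign sigma(t, j), and everything is scaled by s^(-1/2); the seed has one
   entry (sigma, h)(t, j) for each pair (t, j).  For a unit vector x, s (|Mx|^2 - 1)
   is the sum over the blocks of
     Z_t = 2 sum_(i < j) x_i x_j sigma_i sigma_j [h_i = h_j].
   Suppose that the entries are independent.  Given h, integrating out the signs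
   one at a time gives E exp(+-Z_t / 40) <= 1 + W / 50 with
   W = sum_(i < j) x_i^2 x_j^2 [h_i = h_j], whose expectation is at most 1 / (2 B).
   Hence E exp(+-sum_t Z_t / 40) <= exp(s / (100 B)), and by
   y^p <= p^p (e^y + e^-y) for even p,
     E (sum_t Z_t)^p <= (40 p)^p 2 exp(s / (100 B)).
   The p-th moment only involves products over 2 p entries, so it is the same
   under 2p-wise independence, and Markov's inequality concludes with p, s and B
   of order log(1/delta), log(1/delta) / eps and 1 / eps.  Each column has s
   nonzero entries, which is within the claimed time because
   log(1/delta) = O((log(1/delta) / log log(1/delta))^2).  If delta is at least
   1 / gamma, the claim on norms is void and the matrix with no rows works. *)

Require Import Defs.
From mathcomp Require Import all_boot all_order all_algebra.
From mathcomp Require Import all_classical all_reals all_analysis.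
From mathcomp Require Import ring lra zify.

Set Implicit Arguments.
Unset Strict Implicit.
Unset Printing Implicit Defensive.

Import Order.TTheory GRing.Theory Num.Theory.
Import numFieldNormedType.Exports.

Local Open Scope classical_set_scope.
Local Open Scope ring_scope.

(** * Signed sums *)

(** Inverting [1 - z <= expR (- z)] bounds [expR z] by [(1 - z)^-1], and [(1 - z) (1 + z + 2 z^2) =
    1 + z^2 (1 - 2 z)] is at least 1 here. *)
Lemma expR_le_quadratic (R : realType) (z : R) :
  z <= 2^-1 -> expR z <= 1 + z + 2 * z ^+ 2.
Proof.
move=> hz; have h1 : 1 - z <= expR (- z) by apply: expR_ge1Dx.
have h0 : 0 < 1 - z by lra.
have -> : expR z = (expR (- z))^-1 by rewrite expRN invrK.
apply: (@le_trans _ _ (1 - z)^-1).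
  by rewrite lef_pV2 // posrE ?expR_gt0.
rewrite -[leLHS]mul1r ler_pdivrMr //.
have := sqr_ge0 z; nra.
Qed.

(** For small [y] the linear terms of the quadratic bounds at [y] and [- y] cancel; from [1/2] on,
    [y <= 2 y^2] makes the larger exponential suffice. *)
Lemma cosh_le_expR_sqr (R : realType) (y : R) :
  (expR y + expR (- y)) / 2 <= expR (2 * y ^+ 2).
Proof.
have aux : forall z : R, 0 <= z ->
    (expR z + expR (- z)) / 2 <= expR (2 * z ^+ 2).
  move=> z z0; have [hz|hz] := lerP z 2^-1.
    apply: (@le_trans _ _ (1 + 2 * z ^+ 2)); last exact: expR_ge1Dx.
    have := expR_le_quadratic hz.
    have /expR_le_quadratic : - z <= 2^-1 by lra.
    rewrite sqrrN; lra.
  apply: (@le_trans _ _ (expR z)).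
    have : expR (- z) <= expR z by rewrite ler_expR; lra.
    lra.
  rewrite ler_expR; nra.
have [/aux//|y0] := lerP 0 y.
by have := aux (- y); rewrite opprK sqrrN addrC; apply; lra.
Qed.

Definition pairsum (R : nmodType) n (G : 'I_n -> 'I_n -> R) : R :=
  \sum_(i < n) \sum_(j < n | (i < j)%N) G i j.

Lemma eq_pairsum (R : nmodType) n (G H : 'I_n -> 'I_n -> R) :
  (forall i j : 'I_n, (i < j)%N -> G i j = H i j) -> pairsum G = pairsum H.
Proof. by move=> GH; apply: eq_bigr => i _; apply: eq_bigr => j /GH. Qed.

Lemma pairsumD (R : nmodType) n (G H : 'I_n -> 'I_n -> R) :
  pairsum (fun i j => G i j + H i j) = pairsum G + pairsum H.
Proof.
by rewrite /pairsum -big_split; apply: eq_bigr => i _; rewrite big_split.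
Qed.

Lemma pairsumZ (R : pzRingType) n (G : 'I_n -> 'I_n -> R) c :
  pairsum (fun i j => c * G i j) = c * pairsum G.
Proof.
by rewrite /pairsum mulr_sumr; apply: eq_bigr => i _; rewrite mulr_sumr.
Qed.

Lemma le_pairsum (R : numDomainType) n (G H : 'I_n -> 'I_n -> R) :
  (forall i j : 'I_n, (i < j)%N -> G i j <= H i j) -> pairsum G <= pairsum H.
Proof. by move=> GH; apply: ler_sum => i _; apply: ler_sum => j /GH. Qed.

Lemma pairsum_ge0 (R : numDomainType) n (G : 'I_n -> 'I_n -> R) :
  (forall i j : 'I_n, 0 <= G i j) -> 0 <= pairsum G.
Proof. by move=> G0; apply: sumr_ge0 => i _; apply: sumr_ge0. Qed.

Lemma exchange_pairsum (R : nmodType) (I : finType) n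
    (G : I -> 'I_n -> 'I_n -> R) :
  \sum_a pairsum (G a) = pairsum (fun i j => \sum_a G a i j).
Proof.
by rewrite /pairsum exchange_big; apply: eq_bigr => i _; rewrite exchange_big.
Qed.

Lemma pairsum_recl (R : nmodType) n (G : 'I_n.+1 -> 'I_n.+1 -> R) :
  pairsum G = \sum_(j < n) G ord0 (lift ord0 j) +
              pairsum (fun i j => G (lift ord0 i) (lift ord0 j)).
Proof.
rewrite /pairsum big_ord_recl; congr (_ + _).
  by rewrite big_mkcond big_ord_recl /= add0r.
apply: eq_bigr => i _.
by rewrite big_mkcond big_ord_recl /= add0r -big_mkcond.
Qed.

Lemma sqr_sum_pairs (R : comPzRingType) n (a : 'I_n -> R) :
  (\sum_i a i) ^+ 2 = \sum_i a i ^+ 2 + 2 * pairsum (fun i j => a i * a j).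
Proof.
elim: n a => [|n IH] a.
  by rewrite /pairsum !big_ord0; ring.
rewrite !big_ord_recl pairsum_recl /= sqrrD IH -mulr_sumr; ring.
Qed.

Lemma big_ffun_bool_recl (R : nmodType) n (F : {ffun 'I_n.+1 -> bool} -> R) :
  let cons b (s : {ffun 'I_n -> bool}) :=
    [ffun i => if unlift ord0 i is Some j then s j else b] in
  \sum_s F s = \sum_s (F (cons true s) + F (cons false s)).
Proof.
move=> cons.
rewrite (reindex (fun p : bool * {ffun 'I_n -> bool} => cons p.1 p.2)) /=.
  by rewrite -(pair_bigA _ (fun b s => F (cons b s))) exchange_big /=;
    apply: eq_bigr => s _; rewrite big_bool.
exists (fun s : {ffun 'I_n.+1 -> bool} => (s ord0, [ffun i => s (lift ord0 i)])).
  move=> [b s] _; rewrite /cons /= ffunE unlift_none; congr (_, _).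
  by apply/ffunP => i; rewrite !ffunE liftK.
move=> s _; apply/ffunP => i; rewrite /cons ffunE /=.
by case: unliftP => [j ->|->]; rewrite ?ffunE.
Qed.

Definition sgn (R : pzRingType) (b : bool) : R := (-1) ^+ b.

Lemma sgn_sqr (R : pzRingType) b : sgn R b ^+ 2 = 1.
Proof. by rewrite /sgn; case: b; rewrite ?expr0 ?expr1n ?expr1 ?sqrrN ?expr1n. Qed.

(* Integrating out one sign adds [l l^T] to the form; the diagonal part costs a
   constant [V], but the off-diagonal mass still drops by at least [V / 2]. *)
Lemma rank_one_update (R : realType) n (q : 'I_n -> 'I_n -> R) (l : 'I_n -> R) :
  let V := \sum_i l i ^+ 2 in
  V + pairsum (fun i j => q i j ^+ 2) <= 400^-1 ->
  pairsum (fun i j => (q i j + 4 * (l i * l j)) ^+ 2) <=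
    pairsum (fun i j => q i j ^+ 2) + V / 2.
Proof.
move=> V hf.
have V0 : 0 <= V by apply: sumr_ge0 => i _; exact: sqr_ge0.
have q0 : 0 <= pairsum (fun i j => q i j ^+ 2).
  by apply: pairsum_ge0 => i j; exact: sqr_ge0.
have [V_eq0|Vn0] := eqVneq V 0.
  rewrite V_eq0 mul0r addr0; apply: le_pairsum => i j _.
  have -> : l i = 0.
    apply/eqP; rewrite -sqrf_eq0.
    by move: V_eq0 => /psumr_eq0P -> // k _; exact: sqr_ge0.
  by rewrite mul0r mulr0 addr0.
have Vgt0 : 0 < V by rewrite lt0r Vn0.
have hl : pairsum (fun i j => (l i * l j) ^+ 2) <= V ^+ 2 / 2.
  have := sqr_sum_pairs (fun i => l i ^+ 2); rewrite -/V => ->.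
  under eq_pairsum => i j _ do rewrite exprMn.
  have : 0 <= \sum_i (l i ^+ 2) ^+ 2 by apply: sumr_ge0 => i _; exact: sqr_ge0.
  lra.
(* AM-GM in the form [8 a b <= 80 V b^2 + a^2 / (5 V)]. Summed, the excess over [P] is at most
   [80 V P + 8 V^2 + V / 10], which is below [V / 2] when [V + P <= 1/400]. *)
apply: (@le_trans _ _ (pairsum (fun i j => (1 + 80 * V) * q i j ^+ 2 +
    (16 + (5 * V)^-1) * (l i * l j) ^+ 2))).
  apply: le_pairsum => i j _; set a := l i * l j; set b := q i j.
  have -> : (b + 4 * a) ^+ 2 = (1 + 80 * V) * b ^+ 2 + (16 + (5 * V)^-1) * a ^+ 2
      - (5 * V)^-1 * (20 * V * b - a) ^+ 2 by field; rewrite Vn0.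
  rewrite lerBlDr lerDl mulr_ge0 ?sqr_ge0 // invr_ge0; lra.
rewrite pairsumD !pairsumZ.
have c0 : 0 <= 16 + (5 * V)^-1 by rewrite addr_ge0 // invr_ge0; lra.
have := ler_wpM2l c0 hl.
have -> : (16 + (5 * V)^-1) * (V ^+ 2 / 2) = 8 * V ^+ 2 + V / 10.
  by field; rewrite Vn0.
move: q0 hf; set P := pairsum (fun i j => q i j ^+ 2) => P0 hf; nra.
Qed.

(** Induction on [n]. Averaging over the first sign yields the hyperbolic cosine of a linear form
    [S] in the others, at most [exp (2 S^2)]. Expanding [S^2] gives a constant [2 V] and changes the
    form to [q' + 4 l l^T]. By [rank_one_update] its mass is at most [P + V / 2], so the smallness
    hypothesis survives, and [2 V + 4 (P + V / 2)] is exactly [4 (V + P)]. *)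
Lemma chaos_mgf (R : realType) n (q : 'I_n -> 'I_n -> R) :
  pairsum (fun i j => q i j ^+ 2) <= 400^-1 ->
  \sum_(s : {ffun 'I_n -> bool})
     expR (pairsum (fun i j => q i j * (sgn R (s i) * sgn R (s j)))) <=
  2 ^+ n * expR (4 * pairsum (fun i j => q i j ^+ 2)).
Proof.
elim: n q => [|n IH] q.
  move=> _; rewrite /pairsum expr0 mul1r big_ord0 mulr0 expR0.
  under eq_bigr => s _ do rewrite big_ord0 expR0.
  by rewrite sumr_const card_ffun !card_ord expn0.
rewrite pairsum_recl => hf.
pose l j := q ord0 (lift ord0 j).
pose q' i j := q (lift ord0 i) (lift ord0 j).
set V := \sum_(j < n) _ in hf *.
rewrite -/(pairsum (fun i j => q' i j ^+ 2)) in hf *.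
have hu := @rank_one_update _ _ q' l hf.
have V0 : 0 <= V by apply: sumr_ge0 => i _; exact: sqr_ge0.
rewrite big_ffun_bool_recl /=.
apply: (@le_trans _ _ (\sum_(s : {ffun 'I_n -> bool}) (2 * expR (2 * V)) *
   expR (pairsum (fun i j => (q' i j + 4 * (l i * l j)) *
                              (sgn R (s i) * sgn R (s j)))))).
  apply: ler_sum => s _; rewrite !pairsum_recl !expRD.
  set S := \sum_j l j * sgn R (s j).
  set Q := pairsum (fun i j => q' i j * (sgn R (s i) * sgn R (s j))).
  have hQ b : pairsum (fun i j : 'I_n => q (lift ord0 i) (lift ord0 j) *
     (sgn R ([ffun i0 => if unlift ord0 i0 is Some j0 then s j0 else b] (lift ord0 i)) *
      sgn R ([ffun i0 => if unlift ord0 i0 is Some j0 then s j0 else b] (lift ord0 j))))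
     = Q.
    by apply: eq_pairsum => i j _; rewrite !ffunE !liftK.
  have hS b : \sum_(j < n) q ord0 (lift ord0 j) *
     (sgn R ([ffun i0 => if unlift ord0 i0 is Some j0 then s j0 else b] ord0) *
      sgn R ([ffun i0 => if unlift ord0 i0 is Some j0 then s j0 else b] (lift ord0 j)))
     = sgn R b * S.
    rewrite mulr_sumr; apply: eq_bigr => j _.
    by rewrite !ffunE !liftK unlift_none /l; ring.
  rewrite !hQ !hS -mulrDl /sgn expr1 expr0 mulN1r mul1r.
  (* Signs square to 1, so the diagonal of [S^2] is [V] and [2 S^2 - 2 V] is purely off-diagonal. *)
  have -> : pairsum (fun i j => (q' i j + 4 * (l i * l j)) *
        ((-1) ^+ s i * (-1) ^+ s j)) = Q + (2 * S ^+ 2 - 2 * V).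
    rewrite /S sqr_sum_pairs.
    under [X in 2 * (X + _)]eq_bigr => i _ do rewrite exprMn sgn_sqr mulr1.
    rewrite -/V.
    have -> : 2 * (V + 2 * pairsum (fun i j => l i * sgn R (s i) * (l j * sgn R (s j))))
      - 2 * V = pairsum (fun i j => 4 * (l i * l j * (sgn R (s i) * sgn R (s j)))).
      rewrite pairsumZ.
      under [in RHS]eq_pairsum => i j _ do rewrite mulrACA.
      by ring.
    rewrite -pairsumD; apply: eq_pairsum => i j _; rewrite /sgn; ring.
  have hc := cosh_le_expR_sqr S.
  rewrite expRD expRB.
  have -> : 2 * expR (2 * V) * (expR Q * (expR (2 * S ^+ 2) / expR (2 * V)))
    = (2 * expR (2 * S ^+ 2)) * expR Q.
    field; exact: lt0r_neq0 (expR_gt0 _).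
  apply: ler_wpM2r; first exact: expR_ge0.
  lra.
rewrite -mulr_sumr exprS.
have hu' : pairsum (fun i j => (q' i j + 4 * (l i * l j)) ^+ 2) <= 400^-1.
  apply: le_trans hu _; move: hf V0; rewrite -/V; lra.
apply: le_trans (ler_wpM2l _ (IH _ hu')) _.
  by rewrite mulr_ge0 // expR_ge0.
rewrite [leLHS]mulrACA -expRD; apply: ler_wpM2l.
  by rewrite mulr_ge0 // exprn_ge0.
rewrite ler_expR; move: hu; rewrite -/V; lra.
Qed.

(** * The sketch with independent entries *)

Section UniformBlocks.
Context (R : realType) (B : nat).
Hypothesis B_gt0 : (0 < B)%N.

(** The indicator of [h i = h j] is the sum over [b] of those of [h i = b = h j]; each is a product
    over coordinates, so its sum over [h] factors. *)
Lemma sum_collisions (d : nat) (i j : 'I_d) : i != j ->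
  \sum_(h : {ffun 'I_d -> 'I_B}) (h i == h j)%:R = B%:R ^+ d / B%:R :> R.
Proof.
move=> ij.
have Bn0 : B%:R != 0 :> R by rewrite pnatr_eq0 -lt0n.
pose F (b : 'I_B) (l : 'I_d) (c : 'I_B) : R :=
  if (l == i) || (l == j) then (c == b)%:R else 1.
transitivity (\sum_(h : {ffun 'I_d -> 'I_B}) \sum_b \prod_l F b l (h l)).
  apply: eq_bigr => h _.
  have E b : \prod_l F b l (h l) = (h i == b)%:R * (h j == b)%:R.
    rewrite (bigD1 i) //= (bigD1 j) /=; last by rewrite eq_sym.
    rewrite /F !eqxx orbT /=.
    rewrite big1 ?mulr1 // => l /andP[/negPf -> /negPf ->] //.
  rewrite (eq_bigr _ (fun b _ => E b)) (bigD1 (h i)) //= eqxx mul1r big1.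
    by rewrite addr0 eq_sym.
  by move=> b; rewrite eq_sym => /negPf ->; rewrite mul0r.
rewrite exchange_big /=.
have E b : \sum_(h : {ffun 'I_d -> 'I_B}) \prod_l F b l (h l) = B%:R ^+ d / B%:R ^+ 2.
  rewrite -bigA_distr_bigA.
  have Fb l : (l == i) || (l == j) -> \sum_c F b l c = 1.
    move=> hl; rewrite /F hl (bigD1 b) //= eqxx big1 ?addr0 //.
    by move=> c /negPf ->.
  have Fc l : ~~ ((l == i) || (l == j)) -> \sum_c F b l c = B%:R.
    by move=> /negPf hl; rewrite /F hl sumr_const card_ord.
  rewrite (bigID (fun l => (l == i) || (l == j))) /= big1 ?mul1r; last exact: Fb.
  rewrite (eq_bigr _ Fc) prodr_const.
  have -> : #|(fun l => ~~ ((l == i) || (l == j)))| = (d - 2)%N.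
    have -> : #|(fun l => ~~ ((l == i) || (l == j)))| = #|[predC pred2 i j]| by apply: eq_card.
    have hc := cardC (pred2 i j); rewrite card2 ij card_ord in hc.
    by move: hc; set u := #|_| => hc; lia.
  have d2 : (2 <= d)%N by have := max_card (pred2 i j); rewrite card2 ij card_ord.
  by rewrite -[in RHS](subnK d2) exprD mulfK // expf_neq0.
rewrite (eq_bigr _ (fun b _ => E b)) sumr_const card_ord -mulr_natl.
by field.
Qed.

Definition block_form d (x : 'I_d -> R) (y : {ffun 'I_d -> bool * 'I_B}) : R :=
  2 * pairsum (fun i j => x i * x j * ((y i).2 == (y j).2)%:R *
                 (sgn R (y i).1 * sgn R (y j).1)).

(** [theta] stands for both [1/40] and [- 1/40]. For fixed buckets the coefficients have mass
    [W h / 400], within reach of [chaos_mgf]; a bound linear in [W h] can then be averaged over the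
    buckets by [sum_collisions]. *)
Lemma block_mgf d (x : 'I_d -> R) (theta : R) :
  \sum_i x i ^+ 2 = 1 -> theta ^+ 2 = 1600^-1 ->
  \sum_y expR (theta * block_form x y) <=
    (2 * B%:R) ^+ d * expR (100^-1 / B%:R).
Proof.
move=> x1 ht.
have pair_le : pairsum (fun i j => x i ^+ 2 * x j ^+ 2) <= 2^-1.
  have := sqr_sum_pairs (fun i => x i ^+ 2); rewrite x1.
  have : 0 <= \sum_i (x i ^+ 2) ^+ 2 by apply: sumr_ge0 => i _; exact: sqr_ge0.
  by rewrite expr1n; lra.
pose W (h : {ffun 'I_d -> 'I_B}) :=
  pairsum (fun i j => x i ^+ 2 * x j ^+ 2 * (h i == h j)%:R).
have W0 h : 0 <= W h.
  by apply: pairsum_ge0 => i j; rewrite mulr_ge0 ?ler0n // mulr_ge0 ?sqr_ge0.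
have W1 h : W h <= 2^-1.
  apply: le_trans pair_le; apply: le_pairsum => i j _.
  apply: ler_piMr; last by rewrite lern1 leq_b1.
  by apply: mulr_ge0; exact: sqr_ge0.
rewrite (reindex (fun p : {ffun 'I_d -> bool} * {ffun 'I_d -> 'I_B} =>
    [ffun i => (p.1 i, p.2 i)])) /=; last first.
  exists (fun y : {ffun 'I_d -> bool * 'I_B} =>
     ([ffun i => (y i).1], [ffun i => (y i).2])).
    by move=> [s h] _ /=; congr (_, _); apply/ffunP => i; rewrite !ffunE.
  by move=> y _; apply/ffunP => i; rewrite !ffunE; case: (y i).
rewrite -(pair_bigA _ (fun (s : {ffun 'I_d -> bool})
  (h : {ffun 'I_d -> 'I_B}) => expR (theta * block_form x [ffun i => (s i, h i)]))) /=.
rewrite exchange_big /=.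
apply: (@le_trans _ _ (\sum_(h : {ffun 'I_d -> 'I_B}) 2 ^+ d * (1 + 50^-1 * W h))).
  apply: ler_sum => h _.
  pose q i j := 2 * theta * (x i * x j) * (h i == h j)%:R.
  have qW : pairsum (fun i j => q i j ^+ 2) = 400^-1 * W h.
    rewrite /W -pairsumZ; apply: eq_pairsum => i j _.
    have -> : q i j ^+ 2 = 4 * theta ^+ 2 * (x i ^+ 2 * x j ^+ 2) * (h i == h j)%:R ^+ 2.
      by rewrite /q; ring.
    by rewrite ht; case: eqP => _; rewrite ?expr1n ?expr0n /=; field.
  have qs : pairsum (fun i j => q i j ^+ 2) <= 400^-1.
    by rewrite qW; have := W1 h; have := W0 h; lra.
  have := chaos_mgf qs; rewrite qW => hm.
  apply: (@le_trans _ _ (2 ^+ d * expR (4 * (400^-1 * W h)))).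
    apply: le_trans hm; rewrite le_eqVlt; apply/orP; left; apply/eqP.
    apply: eq_bigr => s _; congr expR.
    rewrite /block_form -!pairsumZ; apply: eq_pairsum => i j _.
    by rewrite /q !ffunE /=; ring.
  rewrite ler_wpM2l ?exprn_ge0 //.
  (* The quadratic term of the bound on [exp (W h / 100)] is absorbed thanks to [W h <= 1/2]. *)
  have hw : 4 * (400^-1 * W h) <= 2^-1 by have := W1 h; lra.
  apply: le_trans (expR_le_quadratic hw) _.
  have := W0 h; have := W1 h; nra.
rewrite -mulr_sumr exprMn -mulrA ler_wpM2l ?exprn_ge0 //.
rewrite big_split /= sumr_const card_ffun !card_ord -mulr_sumr exchange_pairsum.
under [X in _ + 50^-1 * X]eq_pairsum => i j ij.
  rewrite -mulr_sumr sum_collisions; last by rewrite neq_ltn ij.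
  rewrite mulrC; over.
rewrite pairsumZ natrX.
have BP : 0 < B%:R :> R by rewrite ltr0n.
have -> : B%:R ^+ d + 50^-1 * (B%:R ^+ d / B%:R * pairsum (fun i j => x i ^+ 2 * x j ^+ 2))
  = B%:R ^+ d * (1 + 50^-1 / B%:R * pairsum (fun i j => x i ^+ 2 * x j ^+ 2)).
  by ring.
rewrite ler_wpM2l ?exprn_ge0 //.
apply: le_trans (expR_ge1Dx _); rewrite lerD2l.
have iB : 0 < B%:R^-1 :> R by rewrite invr_gt0.
move: iB pair_le; set u := B%:R^-1; set P := pairsum _; nra.
Qed.

Lemma blocks_mgf d s (x : 'I_d -> R) (theta : R) :
  \sum_i x i ^+ 2 = 1 -> theta ^+ 2 = 1600^-1 ->
  \sum_(w : {ffun 'I_s -> {ffun 'I_d -> bool * 'I_B}})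
      expR (theta * \sum_t block_form x (w t)) <=
    ((2 * B%:R) ^+ d) ^+ s * expR (s%:R * (100^-1 / B%:R)).
Proof.
move=> x1 ht.
under eq_bigr => w _ do rewrite mulr_sumr expR_sum.
rewrite -(bigA_distr_bigA (fun t y => expR (theta * block_form x y))).
rewrite prodr_const card_ord expRM_natl -exprMn.
apply: lerXn2r; rewrite ?nnegrE; last exact: block_mgf.
- by apply: sumr_ge0 => y _; exact: expR_ge0.
- by rewrite mulr_ge0 ?expR_ge0 // exprn_ge0.
Qed.

(** For nonnegative [z], raise [z / p <= expR (z / p)] to the power [p]; evenness of [p] reduces
    negative [y] to [- y]. *)
Lemma exprn_le_expR (y : R) p : ~~ odd p ->
  y ^+ p <= p%:R ^+ p * (expR y + expR (- y)).
Proof.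
have aux (z : R) : 0 <= z -> z ^+ p <= p%:R ^+ p * (expR z + expR (- z)).
  move=> z0; case: (posnP p) => [->|p0].
    by rewrite !expr0 mul1r; have := expR_ge1Dx z; have := expR_ge0 (- z); lra.
  have pP : 0 < p%:R :> R by rewrite ltr0n.
  apply: (@le_trans _ _ (p%:R ^+ p * expR z)); last first.
    by rewrite ler_wpM2l ?exprn_ge0 // lerDl expR_ge0.
  have -> : expR z = expR (z / p%:R) ^+ p.
    by rewrite -expRM_natl mulrC divfK // gt_eqF.
  rewrite -exprMn; apply: lerXn2r; rewrite ?nnegrE ?mulr_ge0 ?expR_ge0 //.
  rewrite -ler_pdivrMl // mulrC; have := expR_ge1Dx (z / p%:R); lra.
move=> hp; have [/aux//|y0] := lerP 0 y.
have -> : y ^+ p = (- y) ^+ p by rewrite exprNn -signr_odd (negbTE hp) mul1r.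
by rewrite addrC; have := aux (- y); rewrite opprK; apply; lra.
Qed.

Lemma blocks_moment d s p (x : 'I_d -> R) : ~~ odd p ->
  \sum_i x i ^+ 2 = 1 ->
  \sum_(w : {ffun 'I_s -> {ffun 'I_d -> bool * 'I_B}})
      (\sum_t block_form x (w t)) ^+ p <=
    (40 * p%:R) ^+ p * (2 * (((2 * B%:R) ^+ d) ^+ s * expR (s%:R * (100^-1 / B%:R)))).
Proof.
move=> hp x1; pose T (w : {ffun 'I_s -> {ffun 'I_d -> bool * 'I_B}}) :=
  \sum_t block_form x (w t).
apply: (@le_trans _ _ (\sum_w (40 * p%:R) ^+ p *
    (expR (40^-1 * T w) + expR (- 40^-1 * T w)))).
  apply: ler_sum => w _; rewrite -/(T w) mulNr.
  have := exprn_le_expR (40^-1 * T w) hp.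
  have -> : T w ^+ p = 40 ^+ p * (40^-1 * T w) ^+ p.
    by rewrite -exprMn mulrA divff // ?mul1r.
  by move=> h; rewrite [in leRHS]exprMn -mulrA ler_wpM2l // exprn_ge0.
rewrite -mulr_sumr ler_wpM2l ?exprn_ge0 ?mulr_ge0 // big_split /=.
have h1 : (40^-1 : R) ^+ 2 = 1600^-1 by field.
have h2 : (- 40^-1 : R) ^+ 2 = 1600^-1 by field.
have := @blocks_mgf d s x _ x1 h1; have := @blocks_mgf d s x _ x1 h2.
by rewrite -/T; lra.
Qed.
End UniformBlocks.

(** * Limited independence *)

Section LimitedIndependence.
Context (R : realFieldType) (I T : finType).
Implicit Types (mu : {ffun I -> T} -> R) (g : {ffun I -> T} -> R).

(** The discrete form of [rwise_independent_entries], as cylinder weights; empty [S] makes the total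
    weight 1. *)
Definition rwise_weights (r : nat) mu :=
  forall (S : {set I}) (a : {ffun I -> T}), (#|S| <= r)%N ->
    \sum_(v : {ffun I -> T} | [forall j in S, v j == a j]) mu v = #|T|%:R ^- #|S|.

Definition depends_on (S : {set I}) g :=
  forall v v' : {ffun I -> T}, {in S, v =1 v'} -> g v = g v'.

Lemma card_agree (S : {set I}) (v : {ffun I -> T}) :
  #|[pred u : {ffun I -> T} | [forall j in S, u j == v j]]| = (#|T| ^ #|~: S|)%N.
Proof.
pose Q i : pred T := fun t => (i \in S) ==> (t == v i).
have -> : #|[pred u : {ffun I -> T} | [forall j in S, u j == v j]]| =
    #|(family Q : simpl_pred {ffun I -> T})|.
  apply: eq_card => u; rewrite [LHS]inE; apply/forall_inP/familyP => h i.
    by apply/implyP => /h.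
  by move=> iS; have /implyP := h i; apply.
have h : (\prod_i \sum_(j | Q i j) 1 = \sum_(f in family Q) 1)%N.
  rewrite (bigA_distr_big_dep Q (fun _ _ => 1%N)).
  by apply: eq_bigr => f _; rewrite big1_eq.
transitivity (\prod_i \sum_(j | Q i j) 1)%N; first by rewrite h sum1_card.
rewrite (bigID (mem S)) /= big1 ?mul1n => [|i iS]; last first.
  by rewrite (eq_bigl (pred1 (v i))) ?big_pred1_eq // => t; rewrite /Q iS.
rewrite (eq_bigr (fun=> #|T|)) => [|i iS].
  by rewrite prod_nat_const; congr (_ ^ _)%N; apply: eq_card => i; rewrite !inE.
rewrite (eq_bigl predT) ?sum1_card // => t.
by rewrite /Q (negbTE iS).
Qed.

(* Averaging [g] over the points that agree with [v] on [S] does not change it,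
   and after exchanging the sums only cylinder weights of [mu] occur. *)
Lemma expectation_depends_on r mu (S : {set I}) g :
    (0 < #|T|)%N -> rwise_weights r mu -> (#|S| <= r)%N -> depends_on S g ->
  \sum_v mu v * g v = (\sum_v g v) / #|T|%:R ^+ #|I|.
Proof.
move=> T0 hmu Sr hg.
have Tn0 : #|T|%:R != 0 :> R by rewrite pnatr_eq0 -lt0n.
have symm (u v : {ffun I -> T}) :
    [forall j in S, u j == v j] = [forall j in S, v j == u j].
  by apply: eq_forallb => j; rewrite eq_sym.
have K : #|T|%:R ^+ #|~: S| * \sum_v mu v * g v =
         (\sum_v g v) * #|T|%:R ^- #|S|.
  rewrite mulr_sumr.
  transitivity (\sum_(v : {ffun I -> T})
    \sum_(u : {ffun I -> T} | [forall j in S, u j == v j]) mu v * g u).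
    apply: eq_bigr => v _.
    rewrite (eq_bigr (fun=> mu v * g v)) => [|u /forall_inP h].
      by rewrite sumr_const card_agree -[RHS]mulr_natl natrX.
    by congr (_ * _); apply: hg => j /h /eqP.
  rewrite (exchange_big_dep predT) //= mulr_suml; apply: eq_bigr => u _.
  rewrite -mulr_suml mulrC; congr (_ * _).
  by rewrite -(hmu S u Sr); apply: eq_bigl => v; rewrite symm.
apply: (mulfI (expf_neq0 #|~: S| Tn0)); rewrite K mulrCA; congr (_ * _).
by rewrite -(cardsC S) exprD invfM mulrCA divff ?mulr1 // expf_neq0.
Qed.

(** The power expands into products of [p] terms, each depending on a union of [p] supports, that
    is, on at most [c * p] coordinates; on such products [mu] agrees with the uniform law. *)
Lemma moment_rwise (E : finType) (phi : E -> {ffun I -> T} -> R)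
    (supp : E -> {set I}) (c p r : nat) mu :
    (0 < #|T|)%N -> rwise_weights r mu -> (c * p <= r)%N ->
    (forall e, (#|supp e| <= c)%N) -> (forall e, depends_on (supp e) (phi e)) ->
  \sum_v mu v * (\sum_e phi e v) ^+ p =
  (\sum_v (\sum_e phi e v) ^+ p) / #|T|%:R ^+ #|I|.
Proof.
move=> T0 hmu cpr hc hphi.
have expand v : (\sum_e phi e v) ^+ p =
    \sum_(f : {ffun 'I_p -> E}) \prod_m phi (f m) v.
  by rewrite -(bigA_distr_bigA (fun (_ : 'I_p) e => phi e v)) prodr_const card_ord.
under eq_bigr => v _ do rewrite expand mulr_sumr.
under [in RHS]eq_bigr => v _ do rewrite expand.
rewrite exchange_big [in RHS]exchange_big /= mulr_suml; apply: eq_bigr => f _.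
apply: (@expectation_depends_on r _ (\bigcup_m supp (f m))) => //.
  apply: leq_trans cpr; rewrite mulnC.
  have -> : (p * c = \sum_(m < p) c)%N by rewrite sum_nat_const card_ord.
  elim/big_rec2: _ => [|m n A _ hA]; first by rewrite cards0.
  by rewrite (leq_trans (leq_card_setU _ _)) // leq_add.
move=> v v' h; apply: eq_bigr => m _; apply: hphi => j jm; apply: h.
by apply/bigcupP; exists m.
Qed.
End LimitedIndependence.

(** * Laws of matrices built from a seed *)

Section FiniteRange.
Context (R : realType) (disp : measure_display) (Om : measurableType disp)
  (P : probability Om R) (T : finType) (V : Om -> T).
Hypothesis mV : forall v, measurable (V @^-1` [set v]).


Lemma prob_finite_range_seq (s : seq T) : uniq s ->
  measurable [set w | V w \in s] /\
  P [set w | V w \in s] = (\sum_(v <- s) fine (P (V @^-1` [set v])))%:E.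
Proof.
elim: s => [_|v s IH /= /andP[vs /IH[ms Es]]].
  rewrite big_nil (_ : [set w | _] = set0) ?measure0 //.
  by apply/seteqP; split.
have E : [set w | V w \in v :: s] = V @^-1` [set v] `|` [set w | V w \in s].
  apply/seteqP; split => w /=; rewrite inE.
    by move=> /orP[/eqP|]; [left|right].
  by move=> [->|->]; rewrite ?eqxx ?orbT.
rewrite E; split; first exact: measurableU.
rewrite measureU //; last first.
  by apply/seteqP; split => // w [/= ->]; rewrite (negbTE vs).
by rewrite big_cons EFinD -Es fineK // fin_num_measure.
Qed.

Lemma prob_finite_range (Q : pred T) :
  P [set w | Q (V w)] = (\sum_(v | Q v) fine (P (V @^-1` [set v])))%:E.
Proof.
rewrite -big_enum /=; have [_ <-] := prob_finite_range_seq (enum_uniq Q).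
by congr (P _); apply/seteqP; split => w /=; rewrite mem_enum.
Qed.
End FiniteRange.

(** A cylinder over [S] is an intersection of single-entry events, whose probabilities multiply. *)
Lemma rwise_weights_law (R : realType) (disp : measure_display)
    (Om : measurableType disp) (P : probability Om R) (r n q : nat)
    (V : Om -> {ffun 'I_n -> 'I_q}) :
  (forall v, measurable (V @^-1` [set v])) ->
  rwise_independent_entries P r V ->
  rwise_weights r (fun v => fine (P (V @^-1` [set v]))).
Proof.
move=> mV hV S a Sr; have [hS uS] := hV S Sr.
apply: EFin_inj; rewrite -(prob_finite_range P mV).
have := hS S (fun j => [set a j]) (subxx S).
have -> : \bigcap_(i in [set i | i \in S]) (fun w => V w i) @^-1` [set a i] =
    [set w | [forall j in S, V w j == a j]].
  apply/seteqP; split => w /=.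
    by move=> h; apply/forall_inP => j /h /= ->.
  by move=> /forall_inP h j /= /h /eqP.
move=> ->; rewrite (eq_bigr (fun=> (q%:R^-1)%:E)); last first.
  by move=> j jS; rewrite (uS j jS) card_ord.
by rewrite prodEFin prodr_const card_ord exprVn.
Qed.

Section SingleSeed.
Context (R : realType) (k d n q r : nat).
Context (F : {ffun 'I_n -> 'I_q} -> 'M[R]_(k, d)).

Definition single_seed : seeds (fun _ : 'I_1 => n) (fun=> q) -> 'M[R]_(k, d) :=
  fun v => F (v ord0).

(** Turns claims about [D] into finite weighted sums over seeds; [mu] is the law of the random
    vector. *)
Lemma constructed_from_weights (D : probability (borel_matrix R k d) R) :
    constructed_from r single_seed D ->
  exists mu : {ffun 'I_n -> 'I_q} -> R,
    [/\ forall v, 0 <= mu v, rwise_weights r mu &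
     forall A : set (borel_matrix R k d), measurable A ->
       D A = (\sum_(v | `[< A (F v) >]) mu v)%:E].
Proof.
move=> [disp [Om [P [V [mV iV _ hD]]]]].
exists (fun v => fine (P (V ord0 @^-1` [set v]))); split.
- by move=> v; rewrite fine_ge0.
- exact: rwise_weights_law.
- move=> A mA; rewrite hD // -(prob_finite_range P (mV ord0)); congr (P _).
  by apply/seteqP; split => w /= /asboolP.
Qed.
End SingleSeed.

(** * Measurable sets of matrices *)

Section BorelMatrix.
Context (R : realType) (k d : nat).
Implicit Type A : set 'M[R]_(k, d).

Lemma closed_measurable_matrix A : closed A ->
  measurable (A : set (borel_matrix R k d)).
Proof.
move=> cA; rewrite -[A]setCK; apply: measurableC.
by apply: sub_sigma_algebra; rewrite /= openC.
Qed.

Lemma finite_measurable_matrix A : finite_set A ->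
  measurable (A : set (borel_matrix R k d)).
Proof.
move=> fA; apply: closed_measurable_matrix.
apply: (accessible_finite_set_closed.1 _ A fA).
exact: hausdorff_accessible (@norm_hausdorff _ _).
Qed.

Lemma continuous_l2norm_mulmx (x : 'cV[R]_d) :
  continuous (fun M : 'M[R]_(k, d) => l2norm (M *m x)).
Proof.
move=> M; rewrite /l2norm.
apply: (@continuous_comp _ _ _
  (fun M : 'M[R]_(k, d) => \sum_i (M *m x) i 0 ^+ 2) Num.sqrt); last first.
  exact: sqrt_continuous.
apply: (continuous_big add_continuous) => i _.
move=> {}M; apply: (@continuous_comp _ _ _
  (fun M : 'M[R]_(k, d) => (M *m x) i 0) (fun y : R => y ^+ 2)); last first.
  exact: exprn_continuous.
rewrite (_ : (fun M0 : 'M[R]_(k, d) => _) =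
             (fun M0 : 'M[R]_(k, d) => \sum_j M0 i j * x j 0)); last first.
  by apply/funext => N; rewrite mxE.
apply: (continuous_big add_continuous) => j _ {}M.
by apply: cvgMr_tmp; [exact: (nbhs_filter M)|exact: (@coord_continuous R k d i j M)].
Qed.

Lemma measurable_l2norm_between (x : 'cV[R]_d) (a b : R) :
  measurable ([set M : 'M[R]_(k, d) | a <= l2norm (M *m x) <= b] :
    set (borel_matrix R k d)).
Proof.
apply: closed_measurable_matrix.
have -> : [set M : 'M[R]_(k, d) | a <= l2norm (M *m x) <= b] =
  (fun M : 'M[R]_(k, d) => l2norm (M *m x)) @^-1` [set` `[a, b]].
  by apply/seteqP; split => M /=; rewrite in_itv.
apply: closed_comp; last exact: itv_closed.
by move=> M _; exact: continuous_l2norm_mulmx.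
Qed.
End BorelMatrix.

(** * Existence of laws: uniformly distributed seeds *)

Section Empirical.
Context (R : realType) (disp : measure_display) (S : measurableType disp).

Definition empirical (T : finType) (t0 : T) (f : T -> S) : probability S R :=
  mnormalize (msum (fun i => \d_(f (nth t0 (enum T) i))) #|T|) \d_(f t0).

Lemma empiricalE (T : finType) (t0 : T) (f : T -> S) (A : set S) :
  empirical t0 f A = ((\sum_t (f t \in A)%:R) / #|T|%:R)%:E.
Proof.
have sumE (B : set S) :
    msum (fun i => \d_(f (nth t0 (enum T) i)) : measure S R) #|T| B
    = (\sum_t (f t \in B)%:R)%:E.
  rewrite /msum -sumEFin -[RHS]big_enum (big_nth t0) big_mkord -cardE.
  by apply: eq_bigr => i _; exact: diracE.
have cT : #|T|%:R != 0 :> R.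
  by rewrite pnatr_eq0 -lt0n; apply/card_gt0P; exists t0.
have sumT : \sum_t (f t \in [set: S])%:R = #|T|%:R :> R.
  by rewrite (eq_bigr (fun=> 1)) ?sumr_const // => t _; rewrite in_setT.
rewrite /= /mnormalize /= !sumE sumT /= eqe (negbTE cT) /=.
by rewrite sumE EFinM.
Qed.
End Empirical.

Section UniformSeed.
Context (R : realType) (n q : nat).
Hypothesis q_gt0 : (0 < q)%N.
Let T : finType := {ffun 'I_n -> 'I_q}.
Let t0 : T := [ffun=> Ordinal q_gt0].
(** The sample space is [nat], all of whose subsets are measurable; a number decodes to the seed at
    that place in the enumeration. *)
Let V (w : nat) : T := nth t0 (enum T) w.
Let P : probability nat R := empirical R t0 (fun t => index t (enum T)).

Let PE (A : set T) : P [set w | A (V w)] = ((\sum_t (t \in A)%:R) / #|T|%:R)%:E.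
Proof.
rewrite empiricalE; congr ((_ / _)%:E); apply: eq_bigr => t _; congr (_%:R).
suff -> : (index t (enum T) \in [set w | A (V w)]) = (t \in A) by [].
by apply/idP/idP; rewrite !inE /= /V nth_index ?mem_enum.
Qed.

(** The indicator of the event is a product over coordinates, so its sum over seeds factors; each
    coordinate outside [J] contributes [q], which the normalisation cancels. *)
Let P_cylinder (J : {set 'I_n}) (B : forall j : 'I_n, set 'I_q) :
  P (\bigcap_(j in [set j | j \in J]) (fun w => V w j) @^-1` B j) =
  (\prod_(j in J) ((\sum_a (a \in B j)%:R) / q%:R))%:E.
Proof.
pose A := [set t : T | forall j, j \in J -> B j (t j)].
have -> : \bigcap_(j in [set j | j \in J]) (fun w => V w j) @^-1` B j =
    [set w | A (V w)] by apply/seteqP; split => w.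
rewrite PE; congr (_%:E).
pose G (j : 'I_n) (a : 'I_q) : R := if j \in J then (a \in B j)%:R else 1.
have AE t : (t \in A)%:R = \prod_j G j (t j) :> R.
  have [tA|tA] := boolP (t \in A).
    rewrite big1 // => j _; rewrite /G; case: ifP => // jJ.
    by move: tA; rewrite inE => /(_ j jJ) h; rewrite mem_set.
  have [j jJ jB] : exists2 j, j \in J & ~ B j (t j).
    move: tA; rewrite notin_setE => /existsNP[j /not_implyP[jJ jB]].
    by exists j.
  by rewrite (bigD1 j) //= /G jJ memNset // mul0r.
rewrite (eq_bigr _ (fun t _ => AE t)) -bigA_distr_bigA.
rewrite (bigID (mem J)) /=.
rewrite [X in X * _ / _](eq_bigr (fun j => \sum_a (a \in B j)%:R)) => [|j jJ];
  last by apply: eq_bigr => a _; rewrite /G jJ.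
rewrite [X in _ * X / _](eq_bigr (fun=> q%:R)) => [|j jJ]; last first.
  rewrite (eq_bigr (fun=> 1)) ?sumr_const ?card_ord // => a _.
  by rewrite /G (negbTE jJ).
rewrite prodr_const big_split /= prodr_const -mulrA; congr (_ * _).
rewrite card_ffun !card_ord natrX exprVn.
have qn0 : q%:R != 0 :> R by rewrite pnatr_eq0 -lt0n.
rewrite -[in X in _ / _ ^+ X](card_ord n) -(cardC (mem J)) exprD.
by rewrite invfM mulrCA divff ?mulr1 // expf_neq0.
Qed.

Let P_entry (j : 'I_n) (B : set 'I_q) :
  P ((fun w => V w j) @^-1` B) = ((\sum_a (a \in B)%:R) / q%:R)%:E.
Proof.
have := P_cylinder [set j]%SET (fun=> B); rewrite big_set1 => <-; congr (P _).
apply/seteqP; split => w /=; first by move=> h i; rewrite /= inE => /eqP ->.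
by move=> h; apply: (h j); rewrite /= inE.
Qed.

(** Under the uniform law the entries are fully independent, which serves every [r]. *)
Lemma single_seed_exists (k d r : nat) (F : {ffun 'I_n -> 'I_q} -> 'M[R]_(k, d)) :
  exists D : probability (borel_matrix R k d) R,
    constructed_from r (single_seed F) D.
Proof.
exists (empirical R t0 (F : T -> borel_matrix R k d)).
exists default_measure_display, nat, P, (fun _ w => V w); split.
- by [].
- move=> i S _; split=> [J B _|j _ a].
    by rewrite P_cylinder -prodEFin; apply: eq_bigr => j _; rewrite P_entry.
  rewrite P_entry card_ord (bigD1 a) //= big1 => [|b ba].
    by rewrite mem_set // addr0 mul1r.
  by rewrite memNset // => /eqP; apply/negP.
- move=> J B _.
  have [J0|/finset.set0Pn[i iJ]] := eqVneq J finset.set0.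
    rewrite J0 big_set0 -(probability_setT P); congr (P _).
    by apply/seteqP; split => // w _ j /=; rewrite inE.
  have -> : J = [set ord0]%SET.
    by apply/finset.setP => j; rewrite [j]ord1 inE eqxx -(ord1 i).
  rewrite big_set1; congr (P _).
  apply/seteqP; split => w /=; first by apply; rewrite /= inE.
  by move=> h j; rewrite /= inE => /eqP ->.
- move=> A mA.
  by rewrite empiricalE; transitivity (P [set w | [set v | A (F v)] (V w)]);
    rewrite ?PE.
Qed.
End UniformSeed.

(** * Multiplication by a matrix with sparse columns *)

(* Cell 0 of IA[0] holds the number c of entries per column and cell j + 1 the
   address of column j: from there on, c consecutive cells of IA[0] and RA[0]
   hold the row indices and the values.  Register i[8] stays 0. *)
Definition sparse_prog : seq instr := [::
  IConst 1 1;
  ILoad 3 0 8;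
  JumpIfZero 3 20;
  JumpIfZero 0 20;
  ISub 0 0 1;
  ILoad 7 1 0;
  RLoad 0 1 0;
  IAdd 7 7 1;
  ILoad 4 0 7;
  IAdd 5 3 8;
  JumpIfZero 5 3;
  ISub 5 5 1;
  ILoad 6 0 4;
  RLoad 1 0 4;
  RMul 1 1 0;
  RLoad 2 2 6;
  RAdd 2 2 1;
  RStore 2 2 6;
  IAdd 4 4 1;
  Jump 10].

Section SparseProg.
Context (R : realFieldType).
Implicit Types s : mstate R.

Lemma iter_step n p i x (IA : nat -> nat -> nat) (RA : nat -> nat -> R) :
    (p < size sparse_prog)%N ->
  iter n.+1 (step sparse_prog) (MState p i x IA RA) =
  iter n (step sparse_prog)
    (exec (nth (Jump 0) sparse_prog p) (MState p i x IA RA)).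
Proof. by move=> hp; rewrite iterSr /step /halted /= leqNgt hp. Qed.

(** One pass through instructions 10 to 19: [i[5]] counts the remaining entries of the column,
    [i[4]] points at the current one and [x[0]] holds the coordinate of the vector. *)
Lemma inner_step s (c : nat) :
    pc s = 10 -> ireg s 1 = 1%N -> ireg s 5 = c.+1 ->
  exists s', iter 10 (step sparse_prog) s = s' /\
    [/\ pc s' = 10, ireg s' 5 = c, ireg s' 4 = (ireg s 4).+1 &
       {in [:: 0; 1; 3; 8]%N, ireg s' =1 ireg s}] /\
    [/\ rreg s' 0 = rreg s 0, iarr s' = iarr s &
      [/\ rarr s' 0 = rarr s 0, rarr s' 1 = rarr s 1 &
        rarr s' 2 = upd (rarr s 2) (iarr s 0 (ireg s 4))
         (rarr s 2 (iarr s 0 (ireg s 4)) + rarr s 0 (ireg s 4) * rreg s 0)]].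
Proof.
case: s => p i x IA RA hp h1 h5; rewrite /= in hp h1 h5.
rewrite {}hp; eexists; split.
  do 10! (rewrite iter_step; last by []; rewrite [exec _ _]/= ?h5); reflexivity.
rewrite /= /upd2 /upd /= ?h1 ?subn1 ?addn1.
split; split => //.
by move=> a; rewrite !inE => /or4P[] /eqP->.
Qed.

(** The output cells are accumulated, so entries of a column that share a row add up. *)
Lemma inner_loop (c : nat) s :
    pc s = 10 -> ireg s 1 = 1%N -> ireg s 5 = c ->
  exists s', iter (10 * c) (step sparse_prog) s = s' /\
    [/\ pc s' = 10, ireg s' 5 = 0%N & {in [:: 0; 1; 3; 8]%N, ireg s' =1 ireg s}] /\
    [/\ iarr s' = iarr s, rarr s' 0 = rarr s 0, rarr s' 1 = rarr s 1 &
      forall a, rarr s' 2 a = rarr s 2 a + \sum_(t < c)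
        if iarr s 0 (ireg s 4 + t)%N == a
        then rarr s 0 (ireg s 4 + t)%N * rreg s 0 else 0].
Proof.
elim: c s => [|c IH] s hpc h1 h5.
  exists s; split => //; split; split => // a.
  by rewrite big_ord0 addr0.
have [s1 [e1 [[p1 i5 i4 ik] [x0 A1 [R0 R1 R2]]]]] := inner_step hpc h1 h5.
have [|s2 [e2 [[p2 j5 jk] [A2 Q0 Q1 Q2]]]] := IH s1 p1 _ i5.
  by rewrite ik ?inE.
exists s2; split; first by rewrite mulnS addnC iterD e1.
split; split => //; rewrite ?A2 ?Q0 ?Q1 //.
  by move=> a ha; rewrite jk ?ik.
move=> a; rewrite Q2 R2 A1 R0 x0 i4 big_ord_recl addn0 addrA; congr (_ + _).
  by rewrite /upd eq_sym; case: eqP => [->|]; rewrite ?addr0.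
by apply: eq_bigr => t _; rewrite /= /bump add1n addSnnS.
Qed.

Lemma outer_entry s (m : nat) :
    pc s = 3 -> ireg s 0 = m.+1 -> ireg s 1 = 1%N -> ireg s 8 = 0%N ->
  exists s', iter 7 (step sparse_prog) s = s' /\
    [/\ pc s' = 10, ireg s' 0 = m, ireg s' 5 = ireg s 3,
       ireg s' 4 = iarr s 0 (iarr s 1 m).+1 &
       {in [:: 1; 3; 8]%N, ireg s' =1 ireg s}] /\
    [/\ rreg s' 0 = rarr s 1 m, iarr s' = iarr s & rarr s' = rarr s].
Proof.
case: s => p i x IA RA hp h0 h1 h8; rewrite /= in hp h0 h1 h8.
rewrite {}hp; eexists; split.
  do 7! (rewrite iter_step; last by []; rewrite [exec _ _]/= ?h0); reflexivity.
rewrite /= /upd2 /upd /= ?h1 ?h0 ?h8 ?subn1 ?addn1 ?addn0.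
split; split => //.
by move=> a; rewrite !inE => /or3P[] /eqP->.
Qed.

Lemma inner_exit s : pc s = 10 -> ireg s 5 = 0%N ->
  step sparse_prog s = MState 3 (ireg s) (rreg s) (iarr s) (rarr s).
Proof. by case: s => p i x IA RA /= -> h; rewrite /step /= h. Qed.

Lemma outer_exit s : pc s = 3 -> ireg s 0 = 0%N ->
  step sparse_prog s = MState 20 (ireg s) (rreg s) (iarr s) (rarr s).
Proof. by case: s => p i x IA RA /= -> h; rewrite /step /= h. Qed.

(** Each coordinate costs 7 steps to load, [10 * c] in the inner loop and 1 to leave it; the last
    [1] is the final exit. Coordinates are processed from the last to the first. *)
Lemma outer_loop (m c : nat) s :
    pc s = 3 -> ireg s 0 = m -> ireg s 1 = 1%N -> ireg s 3 = c ->
    ireg s 8 = 0%N ->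
  exists s', iter ((8 + 10 * c) * m + 1) (step sparse_prog) s = s' /\ pc s' = 20 /\
    forall a, rarr s' 2 a = rarr s 2 a + \sum_(u < m) \sum_(t < c)
      let b := (iarr s 0 (iarr s 1 u).+1 + t)%N in
      if iarr s 0 b == a then rarr s 0 b * rarr s 1 u else 0.
Proof.
elim: m s => [|m IH] s hpc h0 h1 h3 h8.
  exists (MState 20 (ireg s) (rreg s) (iarr s) (rarr s)); split.
    by rewrite muln0; exact: outer_exit.
  by split => //= a; rewrite big_ord0 addr0.
have [s1 [e1 [[p1 i0 i5 i4 ik] [x0 A1 R1]]]] := outer_entry hpc h0 h1 h8.
have [||s2 [e2 [[p2 j5 jk] [A2 Q0 Q1 Q2]]]] := @inner_loop c s1 p1.
- by rewrite ik ?inE.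
- by rewrite i5 h3.
have [//|||||s3 [e3 [p3 hs3]]] :=
    IH (MState 3 (ireg s2) (rreg s2) (iarr s2) (rarr s2)).
- by rewrite /= jk ?inE.
- by rewrite /= jk ?inE // ik ?inE.
- by rewrite /= jk ?inE // ik ?inE.
- by rewrite /= jk ?inE // ik ?inE.
exists s3; split.
  have -> : ((8 + 10 * c) * m.+1 + 1 =
             ((8 + 10 * c) * m + 1) + (1 + (10 * c + 7)))%N by rewrite mulnS; lia.
  by rewrite iterD [iter (1 + _) _ _]iterD [iter (_ + 7) _ _]iterD e1 e2
    [iter 1 _ _](inner_exit p2 j5).
split => // a; rewrite hs3 /= Q2 A2 Q0 Q1 A1 R1 x0 i4 big_ord_recr /=.
by rewrite -addrA; congr (_ + _); rewrite addrC.
Qed.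

Lemma prologue s : pc s = 0%N -> ireg s 8 = 0%N ->
  exists s', iter 3 (step sparse_prog) s = s' /\
    [/\ pc s' = if iarr s 0 0 == 0%N then 20 else 3, ireg s' 0 = ireg s 0,
      ireg s' 1 = 1%N, ireg s' 3 = iarr s 0 0 & ireg s' 8 = 0%N] /\
    iarr s' = iarr s /\ rarr s' = rarr s.
Proof.
case: s => p i x IA RA hp h8; rewrite /= in hp h8.
rewrite {}hp; eexists; split.
  do 3! (rewrite iter_step; last by []; rewrite [exec _ _]/= ?h8); reflexivity.
by rewrite /= /upd /= ?h8.
Qed.

Lemma sum_support (d : nat) (x : 'cV[R]_d) (G : nat -> R -> R) :
    (forall j, G j 0 = 0) ->
  \sum_(u < l0norm x) G (nth 0%N [seq nat_of_ord j | j <- support_seq x] u)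
                        (nth 0 [seq x j 0 | j <- support_seq x] u) =
  \sum_(j < d) G j (x j 0).
Proof.
move=> G0.
have -> : l0norm x = size (support_seq x).
  by rewrite /l0norm cardsE cardE /support_seq /enum_mem -filter_predI;
    congr size; apply: eq_filter => j; rewrite /= !inE andbT.
transitivity (\sum_(j <- support_seq x) G j (x j 0)).
  have [->|] := eqVneq (support_seq x) [::]; first by rewrite big_ord0 big_nil.
  case E : (support_seq x) => [//|j0 s0] _.
  rewrite (big_nth j0) big_mkord; apply: eq_bigr => u _.
  by rewrite !(nth_map j0).
rewrite /support_seq big_filter big_enum_cond /= big_mkcond /=.
by apply: eq_bigr => j _; case: eqP => [->|].
Qed.

Lemma sparse_computes (k d c : nat) (M : 'M[R]_(k, d))
    (row : nat -> nat -> nat) (val : nat -> nat -> R) (time : 'cV[R]_d -> R) :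
  (forall (i : 'I_k) (j : 'I_d),
     M i j = \sum_(t < c) if row j t == i then val j t else 0) ->
  (forall x, (18 * (c * l0norm x + 1))%:R <= time x) ->
  computes_in_time sparse_prog M time.
Proof.
move=> HM htime.
(* The count [c] and [d] addresses fill the first [d.+1] cells; beyond them, quotient and remainder
   by [c] recover the column and the entry. *)
pose fi a := if a == 0%N then c else if (a <= d)%N then (d.+1 + a.-1 * c)%N else
  row ((a - d.+1) %/ c)%N ((a - d.+1) %% c)%N.
pose fr a := val ((a - d.+1) %/ c)%N ((a - d.+1) %% c)%N.
have cell (j : 'I_d) (t : 'I_c) : [/\ (d.+1 + j * c + t < d.+1 + d * c)%N,
    fi (d.+1 + j * c + t)%N = row j t & fr (d.+1 + j * c + t)%N = val j t].
  have jd := ltn_ord j; have tc := ltn_ord t.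
  have c0 : (0 < c)%N := leq_ltn_trans (leq0n t) tc.
  have e : (d.+1 + j * c + t - d.+1)%N = (j * c + t)%N by lia.
  rewrite /fi /fr e divnMDl // modnMDl modn_small // divn_small // addn0.
  split; [by nia | | by []].
  by rewrite (_ : (d.+1 + j * c + t <= d)%N = false) //; apply/negbTE; lia.
exists (mkseq fi (d.+1 + d * c)), (mkseq fr (d.+1 + d * c)) => x.
have fi0 : nth 0%N (mkseq fi (d.+1 + d * c)) 0 = c by rewrite nth_mkseq.
set di := mkseq fi _ in fi0 *; set dr := mkseq fr _.
have [//|//|s1 [e1 [[p1 i0 i1 i3 i8] [A1 R1]]]] := @prologue (init di dr x).
have H3 : ireg s1 3 = c := etrans i3 fi0.
have {}p1 : pc s1 = if c == 0%N then 20 else 3 by rewrite p1 -[in RHS]fi0.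
(* With [c = 0] the program halts after the 3 steps of the prologue. Otherwise [c >= 1] absorbs the
   overhead of 8 steps per coordinate into [18 * c]. *)
case: (posnP c) => [c0|c_gt0].
  exists 3%N; rewrite e1; split.
  - by apply: le_trans (htime x); rewrite ler_nat; lia.
  - by rewrite /halted p1 c0.
  - move=> i; rewrite R1 /= !mxE big1 // => j _.
    by rewrite HM c0 big_ord0 mul0r.
rewrite ifF in p1; last by lia.
have [s2 [e2 [p2 hs2]]] := outer_loop p1 (etrans i0 erefl) i1 H3 i8.
exists (((8 + 10 * c) * l0norm x + 1) + 3)%N; rewrite iterD e1.
split => [||i].
- by apply: le_trans (htime x); rewrite ler_nat; nia.
- by rewrite e2 /halted p2.
rewrite e2 hs2 A1 R1 /= add0r mxE.
pose G (j : nat) (y : R) := \sum_(t < c)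
   if nth 0%N di (nth 0%N di j.+1 + t)%N == i
   then nth 0 dr (nth 0%N di j.+1 + t)%N * y else 0.
transitivity (\sum_(j < d) G j (x j 0)).
  apply: (@sum_support _ x G) => j.
  by apply: big1 => t _; rewrite mulr0 if_same.
apply: eq_bigr => j _; rewrite HM mulr_suml; apply: eq_bigr => t _.
have [lt hi hr] := cell j t.
have -> : nth 0%N di j.+1 = (d.+1 + j * c)%N.
  rewrite nth_mkseq /fi; last by have := ltn_ord j; lia.
  by rewrite /= ltn_ord.
by rewrite !nth_mkseq // hi hr; case: eqP; rewrite ?mul0r.
Qed.
End SparseProg.

(** * The sketching matrix *)

Lemma l2norm_ge0 (R : rcfType) n (x : 'cV[R]_n) : 0 <= l2norm x.
Proof. exact: sqrtr_ge0. Qed.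

Lemma l2norm_sqr (R : rcfType) n (x : 'cV[R]_n) :
  l2norm x ^+ 2 = \sum_i x i 0 ^+ 2.
Proof. by rewrite sqr_sqrtr // sumr_ge0 // => i _; exact: sqr_ge0. Qed.

Lemma l2normZ (R : rcfType) n (c : R) (x : 'cV[R]_n) : 0 <= c ->
  l2norm (c *: x) = c * l2norm x.
Proof.
move=> c0; apply/eqP; rewrite -(@eqrXn2 _ 2) ?mulr_ge0 ?l2norm_ge0 //.
rewrite exprMn !l2norm_sqr mulr_sumr; apply/eqP; apply: eq_bigr => i _.
by rewrite mxE exprMn.
Qed.

(** With [u] the norm, [u + 1 >= 1] and [u^2 - 1 = (u - 1) (u + 1)] bound the distance from [u] to 1
    by that from [u^2] to 1. *)
Lemma l2norm_between (R : rcfType) n (z : 'cV[R]_n) (eps : R) :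
  0 < eps < 1 -> `|l2norm z ^+ 2 - 1| <= eps -> 1 - eps <= l2norm z <= 1 + eps.
Proof.
move=> /andP[e0 e1]; rewrite ler_norml => /andP[h1 h2].
have := l2norm_ge0 z; set u := l2norm z in h1 h2 *; move=> u0.
by apply/andP; split; nra.
Qed.

(** Each column lies in exactly one bucket, which gives the diagonal; a cross term survives only if
    its two columns collide. *)
Lemma bucket_sums (R : realType) (B d : nat) (x : 'I_d -> R)
    (y : {ffun 'I_d -> bool * 'I_B}) :
  \sum_b (\sum_j (if (y j).2 == b then sgn R (y j).1 * x j else 0)) ^+ 2 =
  \sum_j x j ^+ 2 + block_form x y.
Proof.
under eq_bigr => b _ do rewrite sqr_sum_pairs.
rewrite big_split /=; congr (_ + _).
  rewrite exchange_big /=; apply: eq_bigr => j _.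
  rewrite (bigD1 (y j).2) //= eqxx exprMn sgn_sqr mul1r big1 ?addr0 // => b.
  by rewrite eq_sym => /negPf ->; rewrite expr0n.
rewrite -mulr_sumr exchange_pairsum /block_form; congr (_ * _).
apply: eq_pairsum => i j _.
rewrite (bigD1 (y i).2) //= eqxx big1 ?addr0 => [|b]; last first.
  by rewrite eq_sym => /negPf ->; rewrite mul0r.
by rewrite eq_sym; case: eqP => _; rewrite ?mulr1 ?mulr0 ?mul0r //; ring.
Qed.

Section Sketch.
Context (R : realType) (s B d : nat).
Hypothesis B_gt0 : (0 < B)%N.
Notation E := ('I_s * 'I_d)%type.
Notation T := (bool * 'I_B)%type.
Notation seed := {ffun 'I_#|{: E}| -> 'I_#|{: T}|}.

(* An entry of the seed encodes a sign together with a bucket. *)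
Definition entries (v : seed) (t : 'I_s) : {ffun 'I_d -> T} :=
  [ffun j => enum_val (v (enum_rank (t, j)))].

(** Rows are pairs of a block and a bucket. The sum over blocks, with at most one nonzero term, fits
    the sparse format of [sparse_computes]. *)
Definition sketch (v : seed) : 'M[R]_(#|{: 'I_s * 'I_B}|, d) :=
  \matrix_(i, j) \sum_(t < s)
    if enum_rank (t, (entries v t j).2) == i
    then sgn R (entries v t j).1 / Num.sqrt s%:R else 0.

Definition distortion (x : 'I_d -> R) (v : seed) : R :=
  \sum_t block_form x (entries v t).

Lemma l2norm_sketch v (x : 'cV[R]_d) : (0 < s)%N ->
  l2norm (sketch v *m x) ^+ 2 =
  \sum_j x j 0 ^+ 2 + distortion (x ^~ 0) v / s%:R.
Proof.
move=> s0; have sn0 : s%:R != 0 :> R by rewrite pnatr_eq0 -lt0n.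
rewrite l2norm_sqr (reindex _ (onW_bij _ (@enum_rank_bij ('I_s * 'I_B)%type))) /=.
rewrite (eq_bigr (fun p => (sketch v *m x) (enum_rank (p.1, p.2)) 0 ^+ 2));
  last by case.
rewrite -(pair_bigA _ (fun (t : 'I_s) (b : 'I_B) =>
   (sketch v *m x) (enum_rank (t, b)) 0 ^+ 2)) /=.
have rowE t b : (sketch v *m x) (enum_rank (t, b)) 0 = (Num.sqrt s%:R)^-1 *
    \sum_j (if (entries v t j).2 == b then sgn R (entries v t j).1 * x j 0 else 0).
  rewrite mxE mulr_sumr; apply: eq_bigr => j _; rewrite mxE.
  rewrite (bigD1 t) //= (inj_eq enum_rank_inj) xpair_eqE eqxx /=.
  rewrite big1 ?addr0 => [|u]; last first.
    by rewrite (inj_eq enum_rank_inj) xpair_eqE => /negPf ->.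
  by case: eqP => _; rewrite ?mul0r ?mulr0 //; ring.
transitivity (\sum_t (\sum_j x j 0 ^+ 2 + block_form (x ^~ 0) (entries v t)) / s%:R).
  apply: eq_bigr => t _; rewrite -bucket_sums mulrC mulr_sumr.
  by apply: eq_bigr => b _; rewrite rowE exprMn exprVn sqr_sqrtr ?ler0n.
rewrite -mulr_suml big_split sumr_const card_ord mulrDl /= -[X in X / _ + _]mulr_natl.
by rewrite mulrAC divff ?mul1r.
Qed.

(** Decoding is a bijection from seeds to families of blocks, which transfers [blocks_moment] to
    seeds. *)
Lemma sum_seed (g : {ffun 'I_s -> {ffun 'I_d -> T}} -> R) :
  \sum_v g [ffun t => entries v t] = \sum_w g w.
Proof.
rewrite [RHS](reindex (fun v : seed => [ffun t => entries v t])) //=.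
exists (fun w : {ffun 'I_s -> {ffun 'I_d -> T}} =>
  [ffun e : 'I_#|{: E}| => enum_rank (w (enum_val e).1 (enum_val e).2)]).
  move=> v _; apply/ffunP => e; rewrite !ffunE -surjective_pairing.
  by rewrite enum_valK enum_valK.
move=> w _; apply/ffunP => t; apply/ffunP => j.
by rewrite !ffunE enum_rankK /= enum_rankK.
Qed.

(** The distortion is a sum of terms that each read at most two entries of the seed, so
    [moment_rwise] with [c = 2] reduces the claim to [blocks_moment]. *)
Lemma distortion_moment r p (mu : seed -> R) (x : 'I_d -> R) :
    rwise_weights r mu -> (2 * p <= r)%N -> ~~ odd p -> \sum_j x j ^+ 2 = 1 ->
  \sum_v mu v * distortion x v ^+ p <=
    (40 * p%:R) ^+ p * (2 * expR (s%:R * (100^-1 / B%:R))).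
Proof.
move=> hmu hr hp x1.
pose phi (e : 'I_s * ('I_d * 'I_d)) (v : seed) : R :=
  if (e.2.1 < e.2.2)%N then
    2 * (x e.2.1 * x e.2.2 * ((entries v e.1 e.2.1).2 == (entries v e.1 e.2.2).2)%:R
      * (sgn R (entries v e.1 e.2.1).1 * sgn R (entries v e.1 e.2.2).1)) else 0.
pose supp (e : 'I_s * ('I_d * 'I_d)) : {set 'I_#|{: E}|} :=
  [set enum_rank (e.1, e.2.1); enum_rank (e.1, e.2.2)]%SET.
have phiE v : distortion x v = \sum_e phi e v.
  rewrite (eq_bigr (fun e => phi (e.1, (e.2.1, e.2.2)) v)); last by move=> [? []].
  rewrite -(pair_bigA _ (fun t p => phi (t, (p.1, p.2)) v)) /=; apply: eq_bigr => t _.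
  rewrite -(pair_bigA _ (fun i j => phi (t, (i, j)) v)) /= /block_form mulr_sumr.
  apply: eq_bigr => i _; rewrite mulr_sumr big_mkcond /=.
  by apply: eq_bigr => j _.
have T0 : (0 < #|'I_#|{: T}| |)%N by rewrite card_ord card_prod card_bool card_ord muln_gt0.
under eq_bigr => v _ do rewrite phiE.
rewrite (moment_rwise (supp := supp) T0 hmu hr); first last.
- move=> e v v' h; rewrite /phi !ffunE !h // /supp !inE eqxx ?orbT //.
- by move=> e; rewrite cards2; case: (_ != _).
under eq_bigr => v _ do rewrite -phiE.
have Tp : 0 < #|'I_#|{: T}| |%:R ^+ #|'I_#|{: E}| | :> R.
  by rewrite exprn_gt0 // ltr0n.
rewrite ler_pdivrMr //.
have := @blocks_moment R B B_gt0 d s p x hp x1.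
rewrite -(sum_seed (fun w => (\sum_t block_form x (w t)) ^+ p)).
have -> : \sum_v (\sum_t block_form x ([ffun t0 => entries v t0] t)) ^+ p =
    \sum_v distortion x v ^+ p.
  apply: eq_bigr => v _; congr (_ ^+ p).
  by apply: eq_bigr => t _; rewrite ffunE.
(* The number of seeds is the factor [((2 B)^d)^s] of [blocks_moment]. *)
move=> h; apply: le_trans h _; rewrite le_eqVlt; apply/orP; left; apply/eqP.
rewrite !card_ord !card_prod card_bool !card_ord natrM -exprM (mulnC d s).
by ring.
Qed.

(** Markov's inequality for the [p]-th power, which is nonnegative as [p] is even. *)
Lemma distortion_tail r p (mu : seed -> R) (x : 'I_d -> R) (u : R) :
    (forall v, 0 <= mu v) -> rwise_weights r mu -> (2 * p <= r)%N -> ~~ odd p ->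
    \sum_j x j ^+ 2 = 1 -> 0 < u ->
  \sum_(v | u < `|distortion x v|) mu v <=
    (40 * p%:R / u) ^+ p * (2 * expR (s%:R * (100^-1 / B%:R))).
Proof.
move=> mu0 hmu hr hp x1 u0.
have up : 0 < u ^+ p by rewrite exprn_gt0.
rewrite expr_div_n mulrAC ler_pdivlMr // mulr_suml.
apply: le_trans (distortion_moment hmu hr hp x1).
rewrite [leRHS](bigID (fun v => u < `|distortion x v|)) /=.
have Dp v : distortion x v ^+ p = `|distortion x v| ^+ p.
  by rewrite -normrX ger0_norm // exprn_even_ge0.
rewrite -[leLHS]addr0; apply: lerD.
  apply: ler_sum => v hv; rewrite ler_wpM2l // Dp.
  by apply: lerXn2r; rewrite ?nnegrE ?normr_ge0 ?ltW.
by apply: sumr_ge0 => v _; rewrite mulr_ge0 // exprn_even_ge0.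
Qed.

Lemma sketch_computes v (time : 'cV[R]_d -> R) :
  (forall x, (18 * (s * l0norm x + 1))%:R <= time x) ->
  computes_in_time sparse_prog (sketch v) time.
Proof.
pose at_ (S : Type) (z : S) (f : 'I_d -> 'I_s -> S) (j t : nat) : S :=
  if (insub j, insub t) is (Some j', Some t') then f j' t' else z.
have atE S (z : S) f (j : 'I_d) (t : 'I_s) : at_ S z f j t = f j t.
  by rewrite /at_ !valK.
apply: (@sparse_computes _ _ _ _ _
  (at_ nat 0%N (fun j t => enum_rank (t, (entries v t j).2) : nat))
  (at_ R 0 (fun j t => sgn R (entries v t j).1 / Num.sqrt s%:R))) => i j.
by rewrite mxE; apply: eq_bigr => t _; rewrite !atE.
Qed.
End Sketch.

(** * Numerical estimates and the choice of parameters *)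

Lemma expR1_sqr_le (R : realType) : expR 1 ^+ 2 <= 20 :> R.
Proof.
have h : expR (2^-1 : R) <= 2 by apply: le_trans (expR_le_quadratic (lexx _)) _; lra.
have -> : expR 1 ^+ 2 = expR (2^-1 : R) ^+ 4.
  by rewrite -!expRM_natl; congr expR; field.
have : expR (2^-1 : R) ^+ 4 <= 2 ^+ 4.
  by apply: lerXn2r; rewrite ?nnegrE ?expR_ge0.
lra.
Qed.

(** These parameters give [s / (100 B) = p] and a base of at most [1/20], so the left side is at
    most [2 (e / 20)^p]; by [e^2 <= 20] this is at most [2 e^-p <= 2 delta]. *)
Lemma sketch_tail_le (R : realType) (delta eps a s B : R) (p : nat) :
  0 < delta -> 0 < eps -> eps^-1 <= a -> ln delta^-1 <= p%:R ->
  s = 800 * p%:R * a -> B = 8 * a ->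
  (40 * p%:R / (eps * s)) ^+ p * (2 * expR (s * (100^-1 / B))) <= 2 * delta.
Proof.
move=> d0 e0 ha hp -> ->.
have a0 : 0 < a by apply: lt_le_trans ha; rewrite invr_gt0.
have an0 : a != 0 by rewrite gt_eqF.
have en0 : eps != 0 by rewrite gt_eqF.
have -> : 800 * p%:R * a * (100^-1 / (8 * a)) = p%:R * 1 by field.
rewrite expRM_natl; set b := _ / _.
have p_ge0 : 0 <= p%:R :> R by [].
have b0 : 0 <= b.
  apply: divr_ge0; first by lra.
  by have := mulr_ge0 (ltW e0) (mulr_ge0 p_ge0 (ltW a0)); lra.
have base : b <= 20^-1.
  rewrite /b; case: (posnP p) => [->|p0]; first by rewrite mulr0 mul0r.
  have pn0 : p%:R != 0 :> R by rewrite pnatr_eq0 -lt0n.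
  have -> : 40 * p%:R / (eps * (800 * p%:R * a)) = 20^-1 * (eps^-1 / a).
    by field; rewrite pn0 an0 en0.
  by rewrite ler_piMr // ler_pdivrMr // mul1r.
have hd : expR (- 1) ^+ p <= delta.
  rewrite -expRM_natl mulrN1 -[leRHS]invrK -[in leRHS](lnK (x := delta^-1)).
    by rewrite -expRN ler_expR lerN2.
  by rewrite posrE invr_gt0.
have h : b ^+ p * expR 1 ^+ p <= expR (- 1) ^+ p.
  rewrite -exprMn; apply: lerXn2r; rewrite ?nnegrE ?expR_ge0 //.
    by rewrite mulr_ge0 ?expR_ge0.
  rewrite expRN -[leRHS]mul1r ler_pdivlMr ?expR_gt0 // -mulrA -expr2.
  have := expR1_sqr_le R; have := sqr_ge0 (expR 1 : R); nra.
have := le_trans h hd; lra.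
Qed.

(** Square [ln L <= 2 exp (ln L / 2)], where the exponential is the square root of [L]. *)
Lemma ln_sqr_le (R : realType) (L : R) : 1 < L -> ln L ^+ 2 <= 4 * L.
Proof.
move=> L1; have L0 : 0 < L by lra.
have y0 : 0 <= ln L by rewrite ln_ge0 // ltW.
have -> : 4 * L = (2 * expR (ln L / 2)) ^+ 2.
  by rewrite exprMn -expRM_natl mulrCA divff // mulr1 lnK //; ring.
apply: lerXn2r; rewrite ?nnegrE ?mulr_ge0 ?expR_ge0 //.
by have := expR_ge1Dx (ln L / 2); lra.
Qed.

(** Homogeneity reduces to a unit vector, for which every seed outside the event of
    [distortion_tail] is good; the zero vector is treated apart. *)
Lemma sketch_norm_prob (R : realType) (s B d r p : nat)
    (D : probability (borel_matrix R #|{: 'I_s * 'I_B}| d) R) (delta eps : R)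
    (x : 'cV[R]_d) :
    (0 < B)%N -> (0 < s)%N -> (2 * p <= r)%N -> ~~ odd p -> 0 < eps < 1 ->
    0 <= delta ->
    (40 * p%:R / (eps * s%:R)) ^+ p *
      (2 * expR (s%:R * (100^-1 / B%:R))) <= delta ->
    constructed_from r (single_seed (@sketch R s B d)) D ->
  ((1 - delta)%:E <= D [set M : 'M[R]_(#|{: 'I_s * 'I_B}|, d) |
     ((1 - eps) * l2norm x <= l2norm (M *m x) <= (1 + eps) * l2norm x)%R])%E.
Proof.
move=> B0 s0 hr hp he d0 htail /constructed_from_weights[mu [mu0 hmu hD]].
rewrite hD; last exact: measurable_l2norm_between.
rewrite lee_fin; pose good v := `[< [set M : 'M[R]_(#|{: 'I_s * 'I_B}|, d) |
  (1 - eps) * l2norm x <= l2norm (M *m x) <= (1 + eps) * l2norm x] (sketch R v) >].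
rewrite (eq_bigl good) //.
have mu1 : \sum_v mu v = 1.
  apply: EFin_inj; rewrite -(probability_setT D) hD; last exact: measurableT.
  by congr EFin; apply: eq_bigl => v; apply/esym/asboolP.
have e0 : 0 < eps by case/andP: he.
have sP : 0 < s%:R :> R by rewrite ltr0n.
have [x0|x_neq0] := eqVneq (l2norm x) 0.
  rewrite (eq_bigl predT) ?mu1 => [|v]; first by lra.
  apply/asboolP => /=; have xE : x = 0.
    apply/colP => i; rewrite mxE; apply/eqP; rewrite -sqrf_eq0; apply/eqP.
    have : \sum_i x i 0 ^+ 2 == 0 by rewrite -l2norm_sqr x0 expr0n.
    by rewrite psumr_eq0 => [/allP/(_ i (mem_index_enum _))/eqP|j _]; rewrite ?sqr_ge0.
  have l20 m : l2norm (0 : 'cV[R]_m) = 0.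
    by rewrite -(scale0r 0) l2normZ // mul0r.
  by rewrite xE mulmx0 !l20 !mulr0 lexx.
have xP : 0 < l2norm x by rewrite lt0r x_neq0 l2norm_ge0.
pose y := (l2norm x)^-1 *: x.
have y1 : \sum_j y j 0 ^+ 2 = 1.
  by rewrite -l2norm_sqr l2normZ ?invr_ge0 ?l2norm_ge0 // mulVf ?expr1n.
have hgood v : `|distortion (y ^~ 0) v| <= eps * s%:R -> good v.
  move=> hv; apply/asboolP; rewrite /=.
  have -> : x = l2norm x *: y by rewrite scalerA divff ?scale1r.
  rewrite -scalemxAr !l2normZ ?invr_ge0 ?l2norm_ge0 //.
  rewrite mulVf // mulr1 ![_ * l2norm x]mulrC !ler_pM2l //.
  apply: l2norm_between => //; rewrite l2norm_sketch // y1 addrAC subrr add0r.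
  by rewrite normrM normfV (ger0_norm (ltW sP)) ler_pdivrMr.
have htl := distortion_tail B0 mu0 hmu hr hp y1 (mulr_gt0 e0 sP).
have {}htl := le_trans htl htail.
have : \sum_(v | ~~ good v) mu v <= delta.
  apply: le_trans htl.
  rewrite [leLHS]big_mkcond [leRHS]big_mkcond; apply: ler_sum => w _.
  case: ifP => [hb|_]; last by case: ifP => _.
  by rewrite ifT // ltNge; apply: contra hb => /hgood.
by move: mu1; rewrite (bigID good) /=; lra.
Qed.

(* The constants are products because numerals of R are unary. *)
Lemma sketch_time_le (R : realType) (L eps : R) (s l0 : nat) :
  expR (expR 1) <= L -> 0 < eps -> s%:R <= 64 * 100 * (eps^-1 * L) ->
  (18 * (s * l0 + 1))%:R <=
    (18 * (256 * 100)) * (eps^-1 * (L * ln (ln L) / ln L) ^+ 2 * l0%:R + 1) :> R.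
Proof.
move=> hL e0 hs.
have L0 : 0 < L by apply: lt_le_trans hL; exact: expR_gt0.
have y1 : expR 1 <= ln L by rewrite -[leLHS]expRK ler_ln ?posrE ?expR_gt0.
have y0 : 0 < ln L by apply: lt_le_trans y1; exact: expR_gt0.
have z1 : 1 <= ln (ln L) by rewrite -[leLHS]expRK ler_ln ?posrE ?expR_gt0.
have L1 : 1 < L by have := expR_ge1Dx (expR 1 : R); have := expR_gt0 (1 : R); lra.
(* Follows from [ln (ln L) >= 1] and [ln L ^+ 2 <= 4 * L]. *)
have hq : L <= 4 * (L * ln (ln L) / ln L) ^+ 2.
  rewrite expr_div_n mulrA ler_pdivlMr ?exprn_gt0 // exprMn.
  apply: (@le_trans _ _ (L * (4 * L))); first by rewrite ler_pM2l // ln_sqr_le.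
  have -> : L * (4 * L) = 4 * (L ^+ 2 * 1) by ring.
  by rewrite !ler_pM2l ?exprn_gt0 // expr_ge1 // (le_trans _ z1).
set Q := (L * _ / _) ^+ 2 in hq *.
have ie0 : 0 < eps^-1 by rewrite invr_gt0.
have hsQ : s%:R <= 256 * 100 * (eps^-1 * Q).
  apply: le_trans hs _; have := ler_wpM2l (ltW ie0) hq; lra.
have := ler_wpM2r (ler0n R l0) hsQ.
rewrite natrM natrD natrM; lra.
Qed.

Theorem theorem2 (R : realType) :
  exists (gamma Ck Ct Cr : R) (m : nat) (prog : seq instr),
  forall delta eps : R,
    0 < delta < 1 -> 0 < eps < 1 -> eps <= (ln delta^-1) ^- 2 ->
  exists k : nat, k%:R <= Ck * (eps ^- 2 * ln delta^-1) /\
  forall d : nat,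
  exists (r : nat) (n q : 'I_m -> nat) (F : seeds n q -> 'M[R]_(k, d)),
  [/\ r%:R <= Cr * ln delta^-1,
      forall i, (q i <= maxn 2 k)%N,
      exists D : probability (borel_matrix R k d) R, constructed_from r F D &
      forall D : probability (borel_matrix R k d) R, constructed_from r F D ->
        (forall x : 'cV[R]_d,
          ((1 - gamma * delta)%:E <=
            D [set M : 'M[R]_(k, d) |
                 (1 - eps) * l2norm x <= l2norm (M *m x)
                   <= (1 + eps) * l2norm x]%R)%E) /\
        (1 < ln delta^-1 ->
          {ae D, forall M : 'M[R]_(k, d),
            computes_in_time prog M (fun x =>
              Ct * (eps^-1 * (ln delta^-1 * ln (ln (ln delta^-1))
                                / ln (ln delta^-1)) ^+ 2
                      * (l0norm x)%:R + 1))})].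
Proof.
(* [gamma] makes the norm bound void when [L <= e^e]; above that, [ln (ln L) >= 1]. The next
   constants come from [s * B], from [sketch_time_le], and from [r = 2 p = 4 l <= 8 L]. *)
exists (expR (expR (expR 1))), (1024 * 100), (18 * (256 * 100)), 8, 1%N, sparse_prog.
move=> delta eps /andP[d0 d1] he _; have /andP[e0 e1] := he.
have iP : 0 < delta^-1 by rewrite invr_gt0.
set L := ln delta^-1.
have L0 : 0 < L by rewrite ln_gt0 // -[ltLHS]invr1 ltf_pV2 ?posrE.
have ie0 : 0 < eps^-1 by rewrite invr_gt0.
have ie2 : 0 < eps ^- 2 by rewrite invr_gt0 exprn_gt0.
have [hL|hL] := lerP L (expR (expR 1)).
  exists 0%N; split; first by have := mulr_gt0 ie2 L0; lra.
  move=> d; exists 0%N, (fun=> 0%N), (fun=> 1%N), (single_seed (fun=> 0)).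
  split; first by lra.
  - by move=> i; rewrite leq_max.
  - exact: single_seed_exists.
  move=> D _; split=> [x|_].
    apply: le_trans (measure_ge0 _ _); rewrite lee_fin subr_le0.
    rewrite -ler_pdivrMr // mul1r -[leLHS]lnK ?posrE // ler_expR.
    exact: hL.
  apply: aeW => M; apply: (@sparse_computes _ _ _ 0
      _ (fun _ _ => 0%N) (fun _ _ => 0)) => [[]//|x].
  rewrite mul0n add0n muln1.
  set Q := (_ / _) ^+ 2; have Q0 : 0 <= Q by exact: sqr_ge0.
  by have := mulr_ge0 (mulr_ge0 (ltW ie0) Q0) (ler0n R (l0norm x)); lra.
have L1 : 1 <= L.
  apply: ltW; apply: le_lt_trans hL.
  by have := expR_ge1Dx (expR 1 : R); have := expR_gt0 (1 : R); lra.
(* Rounding up at most doubles [eps^-1] and [L], both at least 1. *)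
pose a := (Num.truncn eps^-1).+1; pose l := (Num.truncn L).+1.
have ha : eps^-1 <= a%:R by apply: ltW; exact: truncnS_gt.
have ha2 : a%:R <= 2 * eps^-1.
  have /andP[+ _] := truncn_itv (ltW ie0); rewrite /a -natr1.
  have : 1 <= eps^-1 by rewrite -[leLHS]invr1 lef_pV2 ?posrE // ltW.
  lra.
have hl : L <= l%:R by apply: ltW; exact: truncnS_gt.
have hl2 : l%:R <= 2 * L by have /andP[+ _] := truncn_itv (ltW L0); rewrite /l -natr1; lra.
pose p := (2 * l)%N; pose s := (800 * p * a)%N; pose B := (8 * a)%N.
have p_even : ~~ odd p by rewrite /p mul2n odd_double.
(* Gives [2 * B <= s * B], the bound on the range of the seed entries by the number of rows. *)
have s2 : (2 <= s)%N.
  by rewrite /s -mulnA (@leq_trans 800) // leq_pmulr // muln_gt0.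
have B0 : (0 < B)%N by rewrite muln_gt0.
have sE : s%:R = 800 * p%:R * a%:R :> R by rewrite /s !natrM.
have BE : B%:R = 8 * a%:R :> R by rewrite /B natrM.
have pE : p%:R = 2 * l%:R :> R by rewrite /p natrM.
clearbody s B p a l.
have hp : L <= p%:R by rewrite pE; lra.
have hs : s%:R <= 64 * 100 * (eps^-1 * L).
  rewrite sE pE.
  have : l%:R * a%:R <= (2 * L) * (2 * eps^-1) by rewrite ler_pM.
  lra.
exists #|{: 'I_s * 'I_B}|; split.
  rewrite card_prod !card_ord natrM BE.
  have : s%:R * a%:R <= 64 * 100 * (eps^-1 * L) * (2 * eps^-1) by rewrite ler_pM.
  rewrite -exprVn expr2; lra.
move=> d; exists (2 * p)%N, (fun=> #|{: 'I_s * 'I_d}|),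
  (fun=> #|{: bool * 'I_B}|), (single_seed (@sketch R s B d)).
split.
- by rewrite natrM pE; lra.
- move=> i; rewrite !card_prod card_bool !card_ord leq_max leq_mul2r s2.
  by rewrite !orbT.
- by apply: single_seed_exists; rewrite card_prod card_bool card_ord muln_gt0.
move=> D hD; split=> [x|_].
  apply: (@le_trans _ _ (1 - 2 * delta)%:E).
    rewrite lee_fin lerD2l lerN2 ler_pM2r //.
    have := expR_ge1Dx (expR (expR 1) : R); have := expR_ge1Dx (expR 1 : R).
    have := expR_gt0 (1 : R); lra.
  apply: (@sketch_norm_prob _ _ _ _ (2 * p) p) hD => //.
  - by rewrite ltnW.
  - by lra.
  - exact: sketch_tail_le d0 e0 ha hp sE BE.
have [mu [_ _ hmu]] := constructed_from_weights hD.
have mR : measurable (~` range (@sketch R s B d) :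
    set (borel_matrix R #|{: 'I_s * 'I_B}| d)).
  by apply: measurableC; apply: finite_measurable_matrix; exact: finite_image.
(* [D] is carried by the finite set of sketches, so its complement is a measurable null set. *)
exists (~` range (@sketch R s B d)); split => //.
  rewrite hmu // big1 // => v /asboolP /= h; exfalso; apply: h.
  by exists v.
move=> M /= hM [v _ vM]; apply: hM; rewrite -vM; apply: sketch_computes => // x.
exact: sketch_time_le (ltW hL) e0 hs.
Qed.
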